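(* Let the density be uniform, $\phi\equiv1$, and let the subdomain $\mathcal{S}(t)\subset\mathbb{R}^2$ be a convex polygon (2-polytope) moving with time. Let $V_i=V_i(p,t)$ be the $i$-th Voronoi cell, with mass $m_i$ and center of mass $c_i$. (1) Write $\partial\mathcal{S}(t)\cap V_i=\bigcup_j\partial\mathcal{S}_i^j$, where $\partial\mathcal{S}_i^j=\overline{v_1^jv_2^j}$ is the $j$-th face of the Voronoi cell shared with the subdomain boundary, a segment with endpoints $v_1^j,v_2^j$, and let $\nu_j(t)$ be the (common) velocity of the points of $\partial\mathcal{S}_i^j$ projected on the unit outward normal. Then the partial derivative $\frac{\partial c_i}{\partial t}=\frac{1}{m_i}\int_{\partial\mathcal{S}(t)\cap V_i}(q-c_i)\big(\frac{dq}{dt}\big)^T\hat n\,dq$ can be expressed as $$\frac{\partial c_i}{\partial t}=\sum_j\frac{\nu_j(t)}{2m_i}\Big((v_2^j-c_i)+(v_1^j-c_i)\Big)\|v_2^j-v_1^j\|.$$ (2) For $j\neq i$ with shared Voronoi face $\partial V_{ij}=V_i\cap V_j=\overline{v_1^jv_2^j}$, a segment with endpoints $v_1^j,v_2^j$, the partial derivative $\frac{\partial c_i}{\partial p_j}=-\frac{1}{m_i\|p_i-p_j\|}\int_{\partial V_{ij}}(q-c_i)(q-p_j)^T\,dq$ can be expressed as $$\frac{\partial c_i}{\partial p_j}=-\frac{\|v_2^j-v_1^j\|}{m_i\|p_i-p_j\|}\Big[(v_1^j-c_i)(v_1^j-p_j)^T+\tfrac12\Big((v_1^j-c_i)(v_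2^j-v_1^j)^T+(v_2^j-v_1^j)(v_1^j-p_j)^T\Big)+\tfrac13(v_2^j-v_1^j)(v_2^j-v_1^j)^T\Big].$$
   Context: Given distinct agent positions $p_1,\dots,p_n\in\mathbb{R}^2$ and a convex time-varying polygon $\mathcal{S}(t)$, the Voronoi cells are $V_i(p,t)=\{q\in\mathcal{S}(t):\|p_i-q\|\le\|p_j-q\|\ \forall j\}$ (convex polygons), with mass and center of mass, for uniform density, $$m_i=\int_{V_i}dq>0,\qquad c_i=\frac1{m_i}\int_{V_i}q\,dq .$$ For $q\in\partial\mathcal{S}(t)$, $\frac{dq}{dt}$ denotes the velocity of the boundary point and $\hat n$ the unit outward normal. It is assumed that on each face $\partial\mathcal{S}_i^j$ the velocity is the same for every point, so that $\nu_j(t)=\big(\frac{dq}{dt}\big)^T\hat n$ is constant along $\partial\mathcal{S}_i^j$. The integrals over $\partial\mathcal{S}(t)\cap V_i$ and over $\partial V_{ij}$ are line integrals with respect to arc length. Here $\frac{\partial c_i}{\partial t}$ and $\frac{\partial c_i}{\partial p_j}$ are the partial derivatives of $c_i(p,t)$ in $t$ (with $p$ fixed) and in $p_j$; under uniform density they are given by the integral formulas displayed in the claim. *)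

(* Defs.v *)
From HB Require Import structures.
From mathcomp Require Import all_boot all_order all_algebra.
From mathcomp Require Import all_classical all_reals all_analysis.
Import Order.TTheory GRing.Theory Num.Theory.
Import numFieldNormedType.Exports.

Set Implicit Arguments.
Unset Strict Implicit.
Unset Printing Implicit Defensive.

Local Open Scope classical_set_scope.
Local Open Scope ring_scope.

(* Euclidean norm; the library norm `|v| on matrices is the sup norm. *)
Definition enorm {R : realType} (v : 'cV[R]_2) : R :=
  Num.sqrt (\sum_(k < 2) v k 0 ^+ 2).

(* Entrywise Lebesgue integral of a matrix-valued function. *)
Definition mxintegral {R : realType} {d : measure_display}
    {T : measurableType d} (mu : {measure set T -> \bar R}) (A : set T)
    (m n : nat) (F : T -> 'M[R]_(m, n)) : 'M[R]_(m, n) :=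
  \matrix_(a, b) \int[mu]_(x in A) F x a b.

(* The library carries planar Lebesgue measure on R * R. *)
Definition plane_pt {R : realType} (z : R * R) : 'cV[R]_2 :=
  \col_k (if k == 0 then z.1 else z.2).

Definition plane_integral {R : realType} (V : set 'cV[R]_2)
    (m n : nat) (F : 'cV[R]_2 -> 'M[R]_(m, n)) : 'M[R]_(m, n) :=
  mxintegral (@lebesgue_measure R \x @lebesgue_measure R)%E
    (plane_pt @^-1` V) (F \o plane_pt).

Definition mass {R : realType} (V : set 'cV[R]_2) : R :=
  (plane_integral V (fun=> 1%:M : 'M[R]_1)) 0 0.

Definition centroid {R : realType} (V : set 'cV[R]_2) : 'cV[R]_2 :=
  (mass V)^-1 *: plane_integral V id.

Definition voronoi {R : realType} {n : nat} (A : set 'cV[R]_2)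
    (p : 'I_n -> 'cV[R]_2) (i : 'I_n) : set 'cV[R]_2 :=
  [set q | A q /\ forall j : 'I_n, enorm (p i - q) <= enorm (p j - q)].

Definition seg_path {R : realType} (a b : 'cV[R]_2) (s : R) : 'cV[R]_2 :=
  a + s *: (b - a).

Definition segment {R : realType} (a b : 'cV[R]_2) : set 'cV[R]_2 :=
  seg_path a b @` `[0, 1].

(* Line integral of F over (segment a b) `&` A with respect to arc length:
   the path above has constant speed enorm (b - a). *)
Definition arc_integral {R : realType} (a b : 'cV[R]_2) (A : set 'cV[R]_2)
    (m n : nat) (F : 'cV[R]_2 -> 'M[R]_(m, n)) : 'M[R]_(m, n) :=
  mxintegral (@lebesgue_measure R) (`[0, 1] `&` seg_path a b @^-1` A)
    (fun s => enorm (b - a) *: F (seg_path a b s)).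

Definition det2 {R : realType} (u v : 'cV[R]_2) : R :=
  u 0 0 * v 1 0 - u 1 0 * v 0 0.

Definition conv_hull {R : realType} {N : nat} (w : 'I_N -> 'cV[R]_2) :
    set 'cV[R]_2 :=
  [set q | exists a : 'I_N -> R,
     [/\ forall k, 0 <= a k, \sum_k a k = 1 & q = \sum_k a k *: w k]].

(* A is the polygon whose vertices, in counterclockwise order, are
   w 0, ..., w (N - 1): every other vertex lies strictly to the left of the
   edge from w k to w (k + 1 mod N). *)
Definition polygon_vertices {R : realType} {N : nat} (w : 'I_N -> 'cV[R]_2)
    (A : set 'cV[R]_2) : Prop :=
  [/\ (2 < N)%N,
      forall k l : 'I_N, l != k -> l != ordS k ->
        0 < det2 (w (ordS k) - w k) (w l - w k)
    & A = conv_hull w].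

Definition convex_polygon {R : realType} (A : set 'cV[R]_2) : Prop :=
  exists (N : nat) (w : 'I_N -> 'cV[R]_2), polygon_vertices w A.

Definition edge {R : realType} {N : nat} (w : 'I_N -> 'cV[R]_2) (k : 'I_N) :
    set 'cV[R]_2 :=
  segment (w k) (w (ordS k)).

(* Outward because the vertices are listed counterclockwise. *)
Definition unit_normal {R : realType} {N : nat} (w : 'I_N -> 'cV[R]_2)
    (k : 'I_N) : 'cV[R]_2 :=
  let u := w (ordS k) - w k in
  (enorm u)^-1 *: \col_l (if l == 0 then u 1 0 else - u 0 0).

(* Line integral over (boundary of the polygon) `&` A; the integrand depends
   on the boundary point and on the unit outward normal there. *)
Definition boundary_integral {R : realType} {N : nat}
    (w : 'I_N -> 'cV[R]_2) (A : set 'cV[R]_2) (m n : nat)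
    (F : 'cV[R]_2 -> 'cV[R]_2 -> 'M[R]_(m, n)) : 'M[R]_(m, n) :=
  \sum_k arc_integral (w k) (w (ordS k)) A (fun q => F q (unit_normal w k)).

Definition boundary {R : realType} (A : set 'cV[R]_2) : set 'cV[R]_2 :=
  closure A `\` interior A.

(* gamma q is the trajectory of the boundary point that sits at q at time t. *)
Definition boundary_motion {R : realType} (S : R -> set 'cV[R]_2) (t : R)
    (gamma : 'cV[R]_2 -> R -> 'cV[R]_2) : Prop :=
  forall q, boundary (S t) q ->
    [/\ gamma q t = q,
        \forall s \near t, boundary (S s) (gamma q s)
      & derivable (gamma q) t 1].

(* Jacobian matrix in the column convention: entry (a, b) is the partial
   derivative of the a-th component in the b-th coordinate. *)
Definition cjacobian {R : realType} (f : 'cV[R]_2 -> 'cV[R]_2)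
    (x : 'cV[R]_2) : 'M[R]_2 :=
  \matrix_(a, b) ('D_(delta_mx b 0) f x) a 0.

(* Main.v *)
(** Along a segment parametrised at constant speed both integrands are
polynomials of degree at most 2 in the parameter, so the closed forms come
from integrating a quadratic over a subinterval of [0, 1].  In (1) the edges
of the polygon that are not among the listed faces contribute nothing: such an
edge lies in the boundary of the polygon, so its part inside the Voronoi cell
is covered by the listed edges, and two distinct edges of a strictly convex
polygon meet only at vertices, which form a null set. *)
Require Import Defs.
From HB Require Import structures.
From mathcomp Require Import all_boot all_order all_algebra.
From mathcomp Require Import all_classical all_reals all_analysis.
From mathcomp Require Import ring lra.
Import Order.TTheory GRing.Theory Num.Theory.
Import numFieldNormedType.Exports.
Local Open Scope classical_set_scope.
Local Open Scope ring_scope.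

Set Implicit Arguments.
Unset Strict Implicit.
Unset Printing Implicit Defensive.

(** * Scalar integrals on the line *)

Lemma Rintegral_quadratic (R : realType) (a b x y z : R) : a <= b ->
  \int[lebesgue_measure]_(s in `[a, b]) (x + s * y + s ^+ 2 * z) =
  (b - a) * x + (b ^+ 2 - a ^+ 2) / 2 * y + (b ^+ 3 - a ^+ 3) / 3 * z.
Proof.
(* The fundamental theorem of calculus is applied with [a < b]; a one-point interval is treated
   apart. *)
rewrite le_eqVlt => /predU1P[<-|ab].
  by rewrite set_itv1 Rintegral_set1 !subrr !mul0r !addr0.
pose F (s : R) : R := s * x + s ^+ 2 * (y / 2) + s ^+ 3 * (z / 3).
have dF s : is_derive s (1 : R) F (x + s * y + s ^+ 2 * z).
  by rewrite /F; apply: is_derive_eq; rewrite /GRing.scale /=; field.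
have cF : continuous F.
  move=> s; apply/differentiable_continuous/derivable1_diffP.
  by have [] := dF s.
rewrite /Rintegral (continuous_FTC2 (F := F) ab).
- by rewrite /= /F; field.
- apply: continuous_subspaceT => s.
  exact/differentiable_continuous/derivable1_diffP.
- split.
  + by move=> s _; have [] := dF s.
  + exact/cvg_at_right_filter/cF.
  + exact/cvg_at_left_filter/cF.
- by move=> s _; rewrite derive1E; have [] := dF s.
Qed.

(** Every subset of a countable set is countable, hence measurable, so an arbitrary [f] is
    measurable on [A], which is a null set. *)
Lemma Rintegral_countable (R : realType) (A : set R) (f : R -> R) :
  countable A -> \int[lebesgue_measure]_(s in A) f s = 0.
Proof.
move=> cA.
have mA (B : set R) : B `<=` A -> measurable B.
  move=> BA; apply: countable_measurable; first exact: measurable_set1.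
  exact: sub_countable (subset_card_le BA) cA.
rewrite /Rintegral null_set_integral//.
- exact: mA.
- by move=> _ Y _; apply: mA; exact: subIsetl.
- exact: countable_lebesgue_measure0.
Qed.

(** * Segments and arc-length integrals along them *)

Lemma enormZ (R : realType) (x : R) (v : 'cV[R]_2) :
  enorm (x *: v) = `|x| * enorm v.
Proof.
rewrite /enorm -sqrtr_sqr -sqrtrM ?sqr_ge0// mulr_sumr.
by under eq_bigr do rewrite mxE exprMn.
Qed.

Lemma seg_path0 (R : realType) (a b : 'cV[R]_2) : seg_path a b 0 = a.
Proof. by rewrite /seg_path scale0r addr0. Qed.

Lemma seg_path1 (R : realType) (a b : 'cV[R]_2) : seg_path a b 1 = b.
Proof. by rewrite /seg_path scale1r addrC subrK. Qed.

Lemma seg_pathB (R : realType) (a b : 'cV[R]_2) (x y : R) :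
  seg_path a b y - seg_path a b x = (y - x) *: (b - a).
Proof. by rewrite /seg_path opprD addrACA subrr add0r -scalerBl. Qed.

Lemma seg_path_comp (R : realType) (a b : 'cV[R]_2) (x y s : R) :
  seg_path (seg_path a b x) (seg_path a b y) s =
  seg_path a b (x + s * (y - x)).
Proof.
by rewrite {1}/seg_path seg_pathB scalerA /seg_path scalerDl addrA.
Qed.

Lemma seg_path_inj (R : realType) (a b : 'cV[R]_2) :
  a != b -> injective (seg_path a b).
Proof.
move=> ab x y xy; apply/eqP; rewrite -subr_eq0.
have /eqP : (x - y) *: (b - a) = 0 by rewrite -seg_pathB xy subrr.
by rewrite scaler_eq0 [b - a == 0]subr_eq0 [b == a]eq_sym (negbTE ab) orbF.
Qed.

Lemma segment_left (R : realType) (a b : 'cV[R]_2) : segment a b a.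
Proof. by exists 0; rewrite ?seg_path0//= in_itv/= lexx ler01. Qed.

Lemma segment_right (R : realType) (a b : 'cV[R]_2) : segment a b b.
Proof. by exists 1; rewrite ?seg_path1//= in_itv/= lexx ler01. Qed.

Lemma segmentC (R : realType) (a b : 'cV[R]_2) : segment a b = segment b a.
Proof.
have sub (c d : 'cV[R]_2) : segment c d `<=` segment d c.
  move=> _ [s /= s01 <-]; exists (1 - s).
    by move: s01; rewrite /= !in_itv/= => /andP[? ?]; apply/andP; split; lra.
  by apply/matrixP => k l; rewrite /seg_path !mxE; ring.
by apply/seteqP; split.
Qed.

Lemma preimage_subsegment (R : realType) (a b : 'cV[R]_2) (x y : R) :
  a != b -> x <= y ->
  seg_path a b @^-1` segment (seg_path a b x) (seg_path a b y) = `[x, y]%classic.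
Proof.
move=> ab xy; apply/seteqP; split=> s /=.
  move=> [r /=]; rewrite in_itv/= => /andP[r0 r1].
  rewrite seg_path_comp => /(seg_path_inj ab) <-.
  by rewrite in_itv/=; apply/andP; split; nra.
rewrite in_itv/= => /andP[xs sy].
(* The parameter of the point on the subsegment is [(s - x) / (y - x)], which makes sense only when
   [x] and [y] differ. *)
have [xy'|xy'] := eqVneq x y.
  have -> : s = x by lra.
  exact: segment_left.
have yx0 : 0 < y - x by rewrite subr_gt0 lt_neqAle xy' xy.
exists ((s - x) / (y - x)).
  by rewrite /= in_itv/= divr_ge0 ?ler_pdivrMr//; lra.
by rewrite seg_path_comp divfK ?gt_eqF// addrC subrK.
Qed.

(** Common source of both closed forms: (1) uses it on a clipped parameter interval with an affine
    integrand, (2) on all of [0, 1] with a quadratic one. *)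
Lemma arc_integral_quadratic (R : realType) (u v : 'cV[R]_2)
    (A : set 'cV[R]_2) (a b : R) (m n : nat) (F : 'cV[R]_2 -> 'M[R]_(m, n))
    (X Y Z : 'M[R]_(m, n)) :
  a <= b -> `[0, 1] `&` seg_path u v @^-1` A = `[a, b]%classic ->
  (forall s, a <= s <= b -> F (seg_path u v s) = X + s *: Y + s ^+ 2 *: Z) ->
  arc_integral u v A F =
  enorm (v - u) *: ((b - a) *: X + ((b ^+ 2 - a ^+ 2) / 2) *: Y +
                    ((b ^+ 3 - a ^+ 3) / 3) *: Z).
Proof.
move=> ab Aab FE; apply/matrixP => k l; rewrite /arc_integral /mxintegral mxE.
set e := enorm _; rewrite Aab.
transitivity (\int[lebesgue_measure]_(s in `[a, b])
    (e * X k l + s * (e * Y k l) + s ^+ 2 * (e * Z k l))).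
  apply: eq_Rintegral => s; rewrite inE/= in_itv/= => sab.
  by rewrite FE// !mxE; ring.
by rewrite Rintegral_quadratic// !mxE; ring.
Qed.

(** The integrand is affine along the segment, so its integral is the length times the mean of its
    two endpoint values. *)
Lemma arc_integral_clipped (R : realType) (a b v1 v2 c : 'cV[R]_2)
    (A : set 'cV[R]_2) (nu : R) (F : 'cV[R]_2 -> 'cV[R]_2) :
  a != b -> segment a b `&` A = segment v1 v2 ->
  (forall q, segment v1 v2 q -> F q = nu *: (q - c)) ->
  arc_integral a b A F =
  (nu / 2 * enorm (v2 - v1)) *: ((v2 - c) + (v1 - c)).
Proof.
move=> ab abA.
have [x x01 v1E] : segment a b v1.
  by have [] : (segment a b `&` A) v1 by rewrite abA; exact: segment_left.
have [y y01 v2E] : segment a b v2.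
  by have [] : (segment a b `&` A) v2 by rewrite abA; exact: segment_right.
move: abA; rewrite -{}v1E -{}v2E.
(* The listed face may run against the direction of the edge; both sides are symmetric in the two
   endpoints. *)
wlog xy : x y x01 y01 / x <= y => [wlg abA FE|abA FE].
  have [xy|/ltW yx] := leP x y; first exact: wlg.
  rewrite [enorm _](_ : _ = enorm (seg_path a b x - seg_path a b y)).
    by rewrite [X in _ *: X]addrC; apply: wlg => //; rewrite [segment (seg_path _ _ _) _]segmentC.
  by rewrite !seg_pathB !enormZ distrC.
have clip : `[0, 1] `&` seg_path a b @^-1` A = `[x, y]%classic.
  rewrite -[RHS](preimage_subsegment ab xy) -abA.
  apply/seteqP; split=> s /= [].
    by move=> s01 As; split=> //; exists s.
  by move=> [r r01 /(seg_path_inj ab) <-] ?; split.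
rewrite (@arc_integral_quadratic _ _ _ _ _ _ _ _ _
  (nu *: (a - c)) (nu *: (b - a)) 0 xy clip); last first.
  move=> s xsy; rewrite FE; last first.
    by have : `[x, y]%classic s by []; rewrite -(preimage_subsegment ab xy).
  by apply/matrixP => k l; rewrite /seg_path !mxE; ring.
rewrite seg_pathB enormZ ger0_norm ?subr_ge0//.
by apply/matrixP => k l; rewrite /seg_path !mxE; field.
Qed.

(** * Edges of a strictly convex polygon *)

Lemma det2_sumr (R : realType) (I : finType) (u : 'cV[R]_2) (a : I -> R)
    (v : I -> 'cV[R]_2) :
  det2 u (\sum_k a k *: v k) = \sum_k a k * det2 u (v k).
Proof.
rewrite /det2 !summxE !mulr_sumr -sumrB; apply: eq_bigr => k _.
by rewrite !mxE; ring.
Qed.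

Lemma det2_seg_path (R : realType) (u v a b : 'cV[R]_2) (s : R) :
  det2 u (seg_path a b s - v) =
  (1 - s) * det2 u (a - v) + s * det2 u (b - v).
Proof. by rewrite /det2 /seg_path !mxE; ring. Qed.

Lemma ordS_neq (N : nat) (k : 'I_N) : (1 < N)%N -> ordS k != k.
Proof.
move=> N1; apply/eqP => /(congr1 val) /=.
have [kN|Nk] := ltnP k.+1 N; first by rewrite modn_small// => /eqP; rewrite eqn_leq ltnn.
have <- : N = k.+1 by apply/eqP; rewrite eqn_leq Nk ltn_ord.
by rewrite modnn => k0; move: Nk; rewrite -k0 leqNgt N1.
Qed.

Lemma ordSS_neq (N : nat) (k : 'I_N) : (2 < N)%N -> ordS (ordS k) != k.
Proof.
move=> N2; apply/eqP => /(congr1 val) /=.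
have kN := ltn_ord k.
have [k1N|Nk] := ltnP k.+1 N; last first.
  have -> : k.+1 = N by apply/eqP; rewrite eqn_leq Nk kN.
  rewrite modnn modn_small ?(ltn_trans _ N2)// => k1.
  by move: Nk; rewrite -k1 leqNgt N2.
rewrite (modn_small k1N).
have [k2N|Nk] := ltnP k.+2 N.
  by rewrite modn_small// => kE; have := leqnSn k.+1; rewrite kE ltnn.
have -> : k.+2 = N by apply/eqP; rewrite eqn_leq Nk k1N.
by rewrite modnn => k0; move: Nk; rewrite -k0 leqNgt N2.
Qed.

(** A degenerate edge has zero determinant against every vertex, yet the third vertex
    [ordS (ordS k)] must lie strictly to its left. *)
Lemma edge_neq (R : realType) (N : nat) (w : 'I_N -> 'cV[R]_2)
    (A : set 'cV[R]_2) (k : 'I_N) :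
  polygon_vertices w A -> w k != w (ordS k).
Proof.
move=> wA; have [N2 left _] := wA; apply/eqP => wk.
have := left k _ (ordSS_neq k N2) (ordS_neq _ (ltnW N2)).
by rewrite -wk subrr /det2 !mxE !mul0r subrr ltxx.
Qed.

(** The inequality puts the polygon in a half-plane; the equality case is what [edgesI] needs to
    identify vertices on the line of an edge. *)
Lemma vertex_left (R : realType) (N : nat) (w : 'I_N -> 'cV[R]_2)
    (A : set 'cV[R]_2) (k l : 'I_N) :
  polygon_vertices w A ->
  0 <= det2 (w (ordS k) - w k) (w l - w k) ?= iff (l \in [:: k; ordS k]).
Proof.
move=> wA; have [_ left _] := wA; rewrite !inE.
have [->|lk] := eqVneq l k.
  by apply/leifP; rewrite /= subrr /det2 !mxE !mulr0 subrr.
have [->|lSk] := eqVneq l (ordS k).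
  by apply/leifP; rewrite /= /det2 mulrC subrr.
by apply/leifP; exact: left.
Qed.

Lemma polygon_left (R : realType) (N : nat) (w : 'I_N -> 'cV[R]_2)
    (A : set 'cV[R]_2) (k : 'I_N) (q : 'cV[R]_2) :
  polygon_vertices w A ->
  A q -> 0 <= det2 (w (ordS k) - w k) (q - w k).
Proof.
move=> wA; have [_ _ ->] := wA => -[a [a0 a1 ->]].
(* The weights sum to 1, so [w k] can be moved inside the convex combination. *)
have -> : \sum_l a l *: w l - w k = \sum_l a l *: (w l - w k).
  under [RHS]eq_bigr do rewrite scalerBr.
  by rewrite sumrB -scaler_suml a1 scale1r.
rewrite det2_sumr sumr_ge0// => l _.
by rewrite mulr_ge0// (vertex_left k l wA).
Qed.

Lemma edge_sub_polygon (R : realType) (N : nat) (w : 'I_N -> 'cV[R]_2)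
    (A : set 'cV[R]_2) (k : 'I_N) :
  polygon_vertices w A -> edge w k `<=` A.
Proof.
move=> wA; have [_ _ ->] := wA => q [s /=]; rewrite in_itv/= => /andP[s0 s1] <-{q}.
exists (fun l => (1 - s) * (l == k)%:R + s * (l == ordS k)%:R).
have sum1 (l : 'I_N) (E : 'I_N -> 'cV[R]_2) :
    \sum_j (j == l)%:R *: E j = E l.
  rewrite (bigD1 l)//= eqxx scale1r big1 ?addr0// => j /negbTE->.
  by rewrite scale0r.
split.
- by move=> l; rewrite addr_ge0// mulr_ge0 ?ler0n ?subr_ge0.
- rewrite big_split/= -!mulr_sumr -!natr_sum.
  have card1 (l : 'I_N) : (\sum_j (j == l) = 1)%N.
    by rewrite (bigD1 l)//= eqxx big1// => j /negbTE->.
  by rewrite !card1 !mulr1 subrK.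
- under eq_bigr do rewrite scalerDl -!scalerA.
  rewrite big_split/= -!scaler_sumr !sum1.
  by apply/matrixP => i j; rewrite /seg_path !mxE; ring.
Qed.

Lemma edge_sub_boundary (R : realType) (N : nat) (w : 'I_N -> 'cV[R]_2)
    (A : set 'cV[R]_2) (k : 'I_N) :
  polygon_vertices w A -> edge w k `<=` boundary A.
Proof.
move=> wA q qk; split.
  exact/subset_closure/(edge_sub_polygon wA)/qk.
pose u := w (ordS k) - w k.
(* Just beyond the edge, on its outer side, there are no points of A. *)
pose nrm : 'cV[R]_2 := \col_l (if l == 0 then u 1 0 else - u 0 0).
have u0 : u != 0 by rewrite subr_eq0 eq_sym (edge_neq k wA).
have nrm_gt0 : 0 < u 0 0 ^+ 2 + u 1 0 ^+ 2.
  rewrite lt_neqAle addr_ge0 ?sqr_ge0// andbT eq_sym.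
  rewrite paddr_eq0 ?sqr_ge0// !sqrf_eq0.
  apply: contra u0 => /andP[/eqP h0 /eqP h1].
  apply/eqP/matrixP => i j; rewrite ord1 [RHS]mxE.
  by move: i => [[|[|//]] ilt]; [rewrite -[RHS]h0|rewrite -[RHS]h1];
    congr (fun_of_matrix u _ _); exact: val_inj.
rewrite /interior /= => qA.
have cg : q + x *: nrm @[x --> (0 : R)^'+] --> q.
  rewrite -[X in _ --> X]addr0 -(scale0r nrm).
  apply: (@cvg_at_right_filter R 'cV[R]_2 (fun x => q + x *: nrm)).
  by apply: cvgD; [exact: cvg_cst|apply: cvgZr_tmp; exact: cvg_id].
have [x [x0 Ax]] : exists x : R, 0 < x /\ A (q + x *: nrm).
  near (0:R)^'+ => x; exists x; split; first by [].
  near: x; exact: cg qA.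
have := polygon_left k wA Ax.
(* Since [q - w k] is parallel to [u], only the displacement [x *: nrm] contributes, and
   [det2 u nrm] is minus the squared length of [u]. *)
have -> : det2 (w (ordS k) - w k) (q + x *: nrm - w k) =
          - x * (u 0 0 ^+ 2 + u 1 0 ^+ 2).
  by case: qk => s _ <-; rewrite /seg_path /det2 /nrm -/u !mxE/=; ring.
by rewrite leNgt mulNr oppr_lt0 mulr_gt0.
Unshelve. all: by end_near.
Qed.

(** The determinant against edge [k] vanishes at [q]. Along edge [l] it is a convex combination of
    two nonnegative values, so each endpoint of [l] either has weight zero or is an endpoint of
    [k]. *)
Lemma edgesI (R : realType) (N : nat) (w : 'I_N -> 'cV[R]_2)
    (A : set 'cV[R]_2) (k l : 'I_N) (q : 'cV[R]_2) :
  polygon_vertices w A -> k != l -> edge w k q -> edge w l q ->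
  q = w k \/ q = w (ordS k).
Proof.
move=> wA kl [r _ <-{q}] [s /=]; rewrite in_itv/= => /andP[s0 s1].
set u := w (ordS k) - w k; set q := seg_path (w k) _ _ => qE.
have [N2 _ _] := wA.
have q0 : det2 u (q - w k) = 0 by rewrite /u /q /det2 /seg_path !mxE; ring.
move: q0; rewrite -qE det2_seg_path => /eqP.
have dl := vertex_left k l wA; have dSl := vertex_left k (ordS l) wA.
rewrite paddr_eq0; last 2 first.
- by rewrite mulr_ge0 ?dl// subr_ge0.
- by rewrite mulr_ge0 ?dSl.
rewrite !mulf_eq0 ![det2 _ _ == 0]eq_sym dl dSl subr_eq0 !inE.
(* Three cases: [s = 1], where [q] is the vertex [ordS l]; [l = k], which is excluded; and
   [l = ordS k], where [ordS l] is off edge [k] and hence [s = 0]. *)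
move=> /andP[/orP[/eqP <-|/orP[|/eqP lE]]].
- by rewrite oner_eq0 seg_path1 /= => /orP[]/eqP ->; [left|right].
- by rewrite eq_sym (negbTE kl).
- rewrite lE (negbTE (ordSS_neq _ N2)) (negbTE (ordS_neq _ (ltnW N2))).
  by rewrite !orbF => /eqP ->; right; rewrite seg_path0.
Qed.

(** * The integral over the polygon boundary inside a cell *)

Lemma boundary_integral_clipped (R : realType) (N r : nat)
    (w : 'I_N -> 'cV[R]_2) (A V : set 'cV[R]_2) (e : 'I_r -> 'I_N)
    (v1 v2 : 'I_r -> 'cV[R]_2) (c : 'cV[R]_2) (nu : 'I_r -> R)
    (F : 'cV[R]_2 -> 'cV[R]_2 -> 'cV[R]_2) :
  polygon_vertices w A -> injective e ->
  (forall j, edge w (e j) `&` V = segment (v1 j) (v2 j)) ->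
  boundary A `&` V = \bigcup_j segment (v1 j) (v2 j) ->
  (forall j q, segment (v1 j) (v2 j) q ->
     F q (unit_normal w (e j)) = nu j *: (q - c)) ->
  boundary_integral w V F =
  \sum_j (nu j / 2 * enorm (v2 j - v1 j)) *: ((v2 j - c) + (v1 j - c)).
Proof.
move=> wA e_inj eV AV FE.
(* Edges in the image of [e] are reindexed by injectivity; the sum over the others is zero. *)
rewrite /boundary_integral (bigID (mem (e @: [set: 'I_r]%SET)))/=.
rewrite [X in _ + X]big1 ?addr0 => [|k ke].
  rewrite big_imset/=; last by move=> ? ? _ _; exact: e_inj.
  apply: eq_big => [j|j _]; first by rewrite finset.inE.
  exact: arc_integral_clipped (edge_neq _ wA) (eV j) (FE j).
(* The unlisted edge k meets V only at endpoints of k. *)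
apply/matrixP => a b; rewrite !mxE Rintegral_countable//.
apply/finite_set_countable/(@sub_finite_set _ _ [set 0; 1]) => [s [s01 Vs]|].
  have qk : edge w k (seg_path (w k) (w (ordS k)) s) by exists s.
  (* By the covering hypothesis the point also lies on a listed edge [e j], which differs from
     [k]. *)
  have [j _] : (\bigcup_j segment (v1 j) (v2 j)) (seg_path (w k) (w (ordS k)) s).
    by rewrite -AV; split=> //; exact: (edge_sub_boundary wA qk).
  rewrite -eV => -[qe _].
  have kej : k != e j by apply: contra ke => /eqP ->; rewrite imset_f.
  have inj := seg_path_inj (edge_neq k wA).
  have [q0|q1] := edgesI wA kej qk qe; [left|right]; apply: inj.
    by rewrite q0 seg_path0.
  by rewrite q1 seg_path1.
exact: finite_set2.
Qed.

Theorem lemma3 (R : realType) (n : nat) (p : 'I_n -> 'cV[R]_2)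
    (S : R -> set 'cV[R]_2) (t : R) (i : 'I_n)
    (p_inj : injective p)
    (S_polygon : forall s, convex_polygon (S s))
    (mass_gt0 : forall k, 0 < mass (voronoi (S t) p k)) :
  let V := voronoi (S t) p i in
  let m := mass V in
  let c := centroid V in
  (forall (N : nat) (w : 'I_N -> 'cV[R]_2)
      (gamma : 'cV[R]_2 -> R -> 'cV[R]_2)
      (r : nat) (e : 'I_r -> 'I_N) (v1 v2 : 'I_r -> 'cV[R]_2)
      (nu : 'I_r -> R),
    polygon_vertices w (S t) ->
    boundary_motion S t gamma ->
    injective e ->
    (forall j, edge w (e j) `&` V = segment (v1 j) (v2 j)) ->
    boundary (S t) `&` V = \bigcup_j segment (v1 j) (v2 j) ->
    (forall j q, segment (v1 j) (v2 j) q ->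
       (derive1 (gamma q) t)^T *m unit_normal w (e j) = (nu j)%:M) ->
    let c_t := fun s => centroid (voronoi (S s) p i) in
    let integral_formula :=
      m^-1 *: boundary_integral w V
        (fun q nhat => (q - c) *m ((derive1 (gamma q) t)^T *m nhat)) in
    let closed_form :=
      \sum_j (nu j / (2 * m) * enorm (v2 j - v1 j))
             *: ((v2 j - c) + (v1 j - c)) in
    integral_formula = closed_form /\
    (derivable c_t t 1 -> derive1 c_t t = integral_formula ->
     derive1 c_t t = closed_form)) /\
  (forall (j : 'I_n) (v1 v2 : 'cV[R]_2),
    j != i ->
    V `&` voronoi (S t) p j = segment v1 v2 ->
    let c_pj := fun x => centroid (voronoi (S t) [eta p with j |-> x] i) in
    let integral_formula :=
      - (m * enorm (p i - p j))^-1 *: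
        arc_integral v1 v2 (V `&` voronoi (S t) p j)
          (fun q => (q - c) *m (q - p j)^T) in
    let closed_form :=
      - (enorm (v2 - v1) / (m * enorm (p i - p j))) *:
        ((v1 - c) *m (v1 - p j)^T
         + 2^-1 *: ((v1 - c) *m (v2 - v1)^T + (v2 - v1) *m (v1 - p j)^T)
         + 3^-1 *: ((v2 - v1) *m (v2 - v1)^T)) in
    integral_formula = closed_form /\
    (differentiable c_pj (p j) -> cjacobian c_pj (p j) = integral_formula ->
     cjacobian c_pj (p j) = closed_form)).
Proof.
move=> V m c; split.
- move=> N w gamma r e v1 v2 nu wS gammaS e_inj eV SV nuE c_t integral_formula.
  move=> closed_form.
  have E : integral_formula = closed_form; last by split=> // _ ->.
  rewrite /integral_formula.
  rewrite (boundary_integral_clipped (c := c) (nu := nu) wS e_inj eV SV).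
    rewrite scaler_sumr; apply: eq_bigr => j _; rewrite scalerA invfM.
    by congr (_ *: _); ring.
  (* The common normal speed turns the 1 by 1 matrix factor into the scalar [nu j]. *)
  by move=> j q qj; rewrite nuE// mul_mx_scalar.
- move=> j v1 v2 ji Vij c_pj integral_formula closed_form.
  have E : integral_formula = closed_form; last by split=> // _ ->.
  (* The shared face is the whole segment, so nothing is clipped. *)
  have full : `[0, 1] `&` seg_path v1 v2 @^-1` (V `&` voronoi (S t) p j) =
              `[0, 1]%classic.
    by rewrite Vij; apply/setIidPl => s s01; exists s.
  (* Coefficients of 1, [s] and [s ^+ 2] in the outer product at [v1 + s *: (v2 - v1)]; the factors
     1/2 and 1/3 are the integrals of [s] and [s ^+ 2] over [0, 1]. *)
  rewrite /integral_formula (@arc_integral_quadratic _ _ _ _ _ _ _ _ _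
    ((v1 - c) *m (v1 - p j)^T)
    ((v1 - c) *m (v2 - v1)^T + (v2 - v1) *m (v1 - p j)^T)
    ((v2 - v1) *m (v2 - v1)^T) ler01 full) => [|s _].
    rewrite /closed_form subr0 !expr1n !expr0n/= !subr0 scale1r !div1r.
    by rewrite scalerA mulNr mulrC.
  have qE x : seg_path v1 v2 s - x = (v1 - x) + s *: (v2 - v1).
    by rewrite /seg_path addrAC.
  rewrite !qE [(_ + _)^T]linearD/= [(_ *: _)^T]linearZ/= mulmxDl !mulmxDr -!scalemxAl -!scalemxAr.
  by rewrite scalerA -expr2 scalerDr !addrA.
Qed.
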